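(* Let $q$ be a prime power and $n$ a positive integer such that every prime divisor of $n$ divides $q-1$, and suppose that $q\equiv 1\pmod 4$ if $8$ divides $n$. Let $f\in\mathbb F_q[x]$ be a monic irreducible polynomial of degree $k$ and order $e$ with $\gcd(ek,n)=1$. Let $r$ be a positive integer with $nr\equiv 1\pmod e$, let $\alpha\in\overline{\mathbb F}_q$ be a root of $f$, let $d=\gcd(n,q-1)$, let $\theta\in\mathbb F_q^*$ have multiplicative order $d$, and set $m=n/d$. For each positive divisor $t$ of $m$ let $g_t(x)=\prod_{i=0}^{k-1}(x-\alpha^{trq^{i}})$. Then the factorization of $f(x^n)$ into monic irreducible polynomials over $\mathbb F_q$ is $$f(x^{n})=\prod_{t\mid m}\ \prod_{\substack{1\le u\le d\\ \gcd(u,t)=1}}\theta^{-uk}\, g_t(\theta^{u}x^{t}).$$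
   Context: $\overline{\mathbb F}_q$ denotes an algebraic closure of $\mathbb F_q$. For a polynomial $f\in\mathbb F_q[x]$ with $f(0)\neq 0$, the order of $f$ is the least positive integer $e$ such that $f(x)$ divides $x^e-1$. *)

(* Defs.v *)
From mathcomp Require Import all_boot all_order all_algebra.

Set Implicit Arguments.
Unset Strict Implicit.
Unset Printing Implicit Defensive.

Import GRing.Theory.
Local Open Scope ring_scope.

(* L, which is algebraically closed by its type, is algebraic over iota(F). *)
Definition is_algebraic_closure (F : fieldType) (L : closedFieldType)
    (iota : {rmorphism F -> L}) : Prop :=
  forall z : L, algebraicOver iota z.

(* Such an e exists only when f.[0] != 0 (for nonconstant f). *)
Definition is_poly_order (F : fieldType) (f : {poly F}) (e : nat) : Prop :=
  [/\ (0 < e)%N,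
      f %| 'X^e - 1
    & forall e' : nat, (0 < e')%N -> f %| 'X^e' - 1 -> (e <= e')%N].

(* g_t, with coefficients a priori only in the algebraic closure. *)
Definition conj_poly (L : fieldType) (q k r : nat) (alpha : L) (t : nat)
    : {poly L} :=
  \prod_(i < k) ('X - (alpha ^+ (t * r * q ^ i))%:P).

(* theta^(-uk) g(theta^u x^t) *)
Definition twist (F : fieldType) (theta : F) (k t u : nat) (g : {poly F})
    : {poly F} :=
  theta ^- (u * k) *: (g \Po (theta ^+ u *: 'X^t)).

(* Main.v *)
(** With beta = alpha^r one has beta^n = alpha, so that over the closure f(X^n) is
    the product over i < k of X^n - (beta^(q^i))^n, and each of these splits as the
    product of X^t - theta^-u beta^(t q^i) over the admissible (t, u), by sorting
    its roots x according to the order t of (x / beta^(q^i))^d. Grouping the factors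
    with the same (t, u) gives the twists. Such a twist is irreducible because the
    Frobenius orbit of each of its roots x has length at least its degree k t:
    if x^(q^j) = x, then k divides j since x^n is a conjugate of alpha, and t
    divides 1 + q + ... + q^(j-1), hence j by a lifting-the-exponent argument. *)

From HB Require Import structures.
Require Import Defs.
From mathcomp Require Import all_boot all_order all_algebra finfield separable.
From mathcomp Require Import ring.

Set Implicit Arguments.
Unset Strict Implicit.
Unset Printing Implicit Defensive.

Import GRing.Theory.
Local Open Scope ring_scope.

(** * Divisibility of geometric sums of powers of [q] *)

Lemma geometric_sum_mod (l q s : nat) :
  q = 1 %[mod l] -> (\sum_(i < s) q ^ i)%N = s %[mod l].
Proof.
move=> ql; rewrite -modn_summ.
under eq_bigr => i _ do rewrite -modnXm ql modnXm exp1n.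
by rewrite modn_summ sum_nat_const card_ord muln1.
Qed.

(** Dividing each exponent by [p] with remainder gives the recursion that removes a prime: the
    number of terms drops to [s] while [q] becomes [q ^ p]. *)
Lemma geometric_sum_mul (q s p : nat) :
  (\sum_(i < p * s) q ^ i = (\sum_(i < s) (q ^ p) ^ i) * \sum_(i < p) q ^ i)%N.
Proof.
elim: s => [|s IHs]; first by rewrite muln0 !big_ord0.
rewrite big_ord_recr mulnDl -IHs /= mulnS addnC big_split_ord /=.
congr (_ + _)%N; rewrite big_distrr /=; apply: eq_bigr => i _.
by rewrite expnD -expnM.
Qed.

(** Modulo [p ^ 2] each power reduces to its linear part, so the sum exceeds [p] by p w times
    p(p-1)/2. This excess vanishes because (p-1)/2 is an integer for odd [p], and because [w] is
    even for [p = 2]. *)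
Lemma prime_geometric_sum_mod_sq (p w : nat) : prime p -> (p = 2 -> 2 %| w)%N ->
  (\sum_(i < p) (1 + p * w) ^ i)%N = p %[mod p ^ 2].
Proof.
move=> pr_p p2.
have pow i : ((1 + p * w) ^ i = 1 + i * (p * w) %[mod p ^ 2])%N.
  elim: i => [|i IHi]; first by rewrite mul0n.
  rewrite expnS -modnMmr IHi modnMmr.
  have ->: ((1 + p * w) * (1 + i * (p * w)) =
            i * w ^ 2 * p ^ 2 + (1 + i.+1 * (p * w)))%N by ring.
  by rewrite modnMDl.
rewrite -modn_summ; under eq_bigr => i _ do rewrite pow.
rewrite modn_summ big_split /= sum_nat_const card_ord muln1 -big_distrl /=.
suff /dvdnP[c ->]: (p ^ 2 %| (\sum_(i < p) i) * (p * w))%N.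
  by rewrite addnC modnMDl.
rewrite [in X in (_ %| X)%N]mulnCA expnS expn1 dvdn_pmul2l ?prime_gt0 //.
rewrite -(big_mkord xpredT (fun i => i)) bin2_sum bin2.
have [p_eq2|p_odd] := even_prime pr_p; first by rewrite {1 2 3}p_eq2 mul1n p2.
have -> : p.-1 = (p.-1./2).*2.
  by rewrite -[LHS]odd_double_half -subn1 oddB ?prime_gt0 // p_odd.
rewrite -doubleMr doubleK.
by rewrite -mulnA dvdn_mulr.
Qed.

(* A lifting-the-exponent lemma, by removing one prime factor of t at a time. *)
Lemma dvdn_geometric_sum (t q s : nat) : (0 < t)%N -> (0 < q)%N ->
    (forall p, prime p -> p %| t -> p %| q - 1)%N ->
    (4 %| t -> 4 %| q - 1)%N ->
  (t %| \sum_(i < s) q ^ i)%N -> (t %| s)%N.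
Proof.
elim/ltn_ind: t q s => t IHt q s t_gt0 q_gt0 tq t4 tS.
have [t1|t_gt1] := leqP t 1.
  by rewrite (_ : t = 1)%N ?dvd1n //; apply/eqP; rewrite eqn_leq t1.
set p := pdiv t; have pr_p : prime p by rewrite pdiv_prime.
have p_t : (p %| t)%N by rewrite pdiv_dvd.
have mod1 l : (l %| q - 1)%N -> q = 1 %[mod l].
  by move=> lq; apply/eqP; rewrite eqn_mod_dvd.
have p_s : (p %| s)%N.
  by rewrite /dvdn -(geometric_sum_mod s (mod1 _ (tq _ pr_p p_t))) -/(dvdn _ _) (dvdn_trans p_t).
have [t' t_eq] := dvdnP p_t; have [s' s_eq] := dvdnP p_s.
have p_gt1 := prime_gt1 pr_p.
have p_S : (p %| \sum_(i < p) q ^ i)%N.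
  by rewrite /dvdn (geometric_sum_mod p (mod1 _ (tq _ pr_p p_t))) modnn.
have [c c_eq] := dvdnP p_S.
have qp1 : (q - 1 %| q ^ p - 1)%N by rewrite !subn1 predn_exp dvdn_mulr.
have t'_gt0 : (0 < t')%N by move: t_gt0; rewrite t_eq muln_gt0 => /andP[].
(* A common prime [l] divides the sum of [p] terms, which is [p] modulo [l], so [l = p]. Then
   [p ^ 2] divides that sum, although it is [p] modulo [p ^ 2]. If [p = 2], this case makes 4 divide
   [t], whence [w] is even. *)
have cop : coprime t' c.
  rewrite /coprime; apply: contraT => g1.
  set l := pdiv (gcdn t' c).
  have g_gt0 : (0 < gcdn t' c)%N by rewrite gcdn_gt0 t'_gt0.
  have pr_l : prime l by rewrite pdiv_prime // ltn_neqAle eq_sym g1.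
  have lt' : (l %| t')%N by apply: dvdn_trans (pdiv_dvd _) (dvdn_gcdl _ _).
  have lc : (l %| c)%N by apply: dvdn_trans (pdiv_dvd _) (dvdn_gcdr _ _).
  have l_t : (l %| t)%N by rewrite t_eq dvdn_mulr.
  have l_p : l = p.
    apply/eqP; rewrite -dvdn_prime2 // /dvdn.
    rewrite -(geometric_sum_mod p (mod1 _ (tq _ pr_l l_t))) -/(dvdn _ _) c_eq.
    exact: dvdn_mulr.
  have [w w_eq] := dvdnP (tq _ pr_p p_t).
  have q_eq : q = (1 + p * w)%N by rewrite mulnC -w_eq subnKC.
  have : (p ^ 2 %| p)%N.
    have w2 : (p = 2 -> 2 %| w)%N.
      move=> p2; have /t4 : (4 %| t)%N.
        by rewrite t_eq (_ : 4 = 2 * 2)%N // dvdn_mul // -?p2 // -l_p.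
      by rewrite w_eq p2 (_ : 4 = 2 * 2)%N // dvdn_pmul2r.
    rewrite /dvdn -(prime_geometric_sum_mod_sq pr_p w2) -q_eq -/(dvdn _ _) c_eq.
    by rewrite expnS expn1 dvdn_mul // -l_p.
  by move/dvdn_leq => /(_ (prime_gt0 pr_p)); rewrite leqNgt -{1}(expn1 p) ltn_exp2l.
have t't : (t' %| t)%N by rewrite t_eq dvdn_mulr.
rewrite t_eq s_eq dvdn_pmul2r ?prime_gt0 //.
(* Since [q - 1] divides [q ^ p - 1], both divisibility hypotheses pass from [q] to [q ^ p]. *)
apply: (IHt t' _ (q ^ p)%N) => //; first by rewrite t_eq ltn_Pmulr.
- by rewrite expn_gt0 q_gt0.
- by move=> l pr_l lt'; apply: dvdn_trans qp1; apply: tq => //; apply: dvdn_trans t't.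
- by move=> lt'; apply: dvdn_trans qp1; apply: t4; apply: dvdn_trans t't.
move: tS; rewrite (etrans s_eq (mulnC _ _)) geometric_sum_mul c_eq t_eq.
by rewrite mulnA dvdn_pmul2r ?prime_gt0 // Gauss_dvdl.
Qed.

(** * Frobenius orbits over a finite field *)

Lemma pchar_nat_card (F : finFieldType) (R : nzRingType) (phi : {rmorphism F -> R}) :
  [pchar R].-nat #|F|.
Proof.
have [p pr_p pF] := finPcharP F.
have card_F : (#|F| = p ^ logn p #|F|)%N := card_pprimeChar pF.
by rewrite card_F pnatX pnatE ?(rmorph_pchar phi).
Qed.

(* The proof argument lets the ring-morphism instance below be inferred. *)
Definition powq (L : fieldType) (q : nat) (qL : [pchar L].-nat q) (x : L) : L := x ^+ q.

Section Powq.
Variables (L : fieldType) (q : nat) (qL : [pchar L].-nat q).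

Fact powq_is_nmod_morphism : nmod_morphism (powq qL).
Proof.
split; first by rewrite /powq expr0n; case: q qL.
by move=> x y; rewrite /powq exprDn_pchar.
Qed.

Fact powq_is_monoid_morphism : monoid_morphism (powq qL).
Proof. by split=> [|x y]; rewrite /powq ?expr1n ?exprMn. Qed.

HB.instance Definition _ :=
  GRing.isNmodMorphism.Build L L (powq qL) powq_is_nmod_morphism.
HB.instance Definition _ :=
  GRing.isMonoidMorphism.Build L L (powq qL) powq_is_monoid_morphism.

Lemma pow_pchar_inj i : injective (fun x : L => x ^+ (q ^ i)).
Proof.
elim: i => [|i IHi] x y; first by rewrite !expr1.
by rewrite !expnSr !exprM => /(fmorph_inj (powq qL))/IHi.
Qed.
End Powq.

Section Orbits.
Variables (F : finFieldType) (L : fieldType) (phi : {rmorphism F -> L}).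
Local Notation q := #|F|.
Let qL := pchar_nat_card phi.

(** X^q - X is the product of the X - a over all a in [F], so its roots in [L] come from [F]. *)
Lemma pow_card_fixed (x : L) : x ^+ q = x -> exists a, phi a = x.
Proof.
move=> xq; have /eqP := congr1 (fun P => (map_poly phi P).[x]) (finField_genPoly F).
rewrite rmorphB /= map_polyXn map_polyX !hornerE xq subrr eq_sym.
rewrite rmorph_prod horner_prod => /prodf_eq0[a _].
by rewrite rmorphB /= map_polyX map_polyC !hornerE subr_eq0 => /eqP->; exists a.
Qed.

Lemma root_pow_card (P : {poly F}) (b : L) i :
  root (map_poly phi P) b -> root (map_poly phi P) (b ^+ (q ^ i)).
Proof.
elim: i => [|i IHi] rb; first by rewrite expr1.
have {}IHi := IHi rb.
rewrite expnSr exprM.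
(* Frobenius fixes the coefficients, since they come from [F]. *)
have -> : map_poly phi P = map_poly (powq qL) (map_poly phi P).
  by apply/polyP => j; rewrite !coef_map /= /powq -rmorphXn expf_card.
exact: (rmorph_root (powq qL)).
Qed.

(** All Frobenius images of [b] are roots of [P], so two of them agree; injectivity of Frobenius
    then cancels the smaller iterate. *)
Lemma exists_pow_period (P : {poly F}) (b : L) : P != 0 -> root (map_poly phi P) b ->
  exists2 s, (0 < s)%N & b ^+ (q ^ s) = b.
Proof.
move=> P0 rb.
have P'0 : map_poly phi P != 0 by rewrite map_poly_eq0.
pose orb := mkseq (fun i => b ^+ (q ^ i)) (size P).
have : ~~ uniq orb.
  apply/negP => /(max_poly_roots P'0).
  rewrite size_mkseq size_map_poly ltnn => /(_ _)/notF; apply.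
  by apply/allP => _ /mapP[i _ ->]; apply: root_pow_card.
case/(uniqPn 0) => i [j [ij]]; rewrite size_mkseq => js.
rewrite !nth_mkseq // ?(ltn_trans ij) // => bij; exists (j - i)%N; first by rewrite subn_gt0.
by apply: (pow_pchar_inj qL (i := i)); rewrite /= -exprM -expnD subnK // ltnW.
Qed.

(** This [s] is the degree of [b] over [F], the length of its Frobenius orbit. *)
Definition pow_period (b : L) s := [/\ (0 < s)%N, b ^+ (q ^ s) = b &
  forall j, b ^+ (q ^ j) = b -> (0 < j)%N -> (s <= j)%N].

Lemma ex_pow_period (P : {poly F}) (b : L) : P != 0 -> root (map_poly phi P) b ->
  exists s, pow_period b s.
Proof.
move=> P0 /(exists_pow_period P0)[s s0 bs].
have ex : exists s, (0 < s)%N && (b ^+ (q ^ s) == b) by exists s; rewrite s0 bs /=.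
have [i /andP[i0 /eqP bi] min_i] := ex_minnP ex.
by exists i; split=> // j bj j0; apply: min_i; rewrite j0 bj /=.
Qed.

Lemma pow_period_dvd b s j : pow_period b s -> b ^+ (q ^ j) = b -> (s %| j)%N.
Proof.
case=> s0 bs min_s bj; apply: contraT; rewrite /dvdn -lt0n => r0.
have bm i : b ^+ (q ^ (i * s)) = b.
  by elim: i => [|i IHi]; rewrite ?expr1 // mulSn expnD exprM bs.
have /min_s/(_ r0) : b ^+ (q ^ (j %% s)) = b; last by rewrite leqNgt ltn_pmod.
by rewrite -{1}(bm (j %/ s)%N) -exprM -expnD -divn_eq.
Qed.

Lemma uniq_orbit b s : pow_period b s -> uniq (mkseq (fun i => b ^+ (q ^ i)) s).
Proof.
case=> s0 _ min_s; apply: contraT => /(uniqPn 0)[i [j [ij]]].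
rewrite size_mkseq => js; rewrite !nth_mkseq // ?(ltn_trans ij) // => bij.
suff /min_s : b ^+ (q ^ (j - i)) = b.
  rewrite subn_gt0 ij => /(_ isT); rewrite leqNgt.
  by rewrite (leq_ltn_trans (leq_subr _ _) js).
by apply: (pow_pchar_inj qL (i := i)); rewrite /= -exprM -expnD subnK // ltnW.
Qed.

(** Frobenius permutes the linear factors cyclically, hence fixes the coefficients of the product.
    Any period is allowed, because [alpha ^+ (t * r)] just inherits the period [k] of [alpha]. *)
Lemma orbit_poly_descent (c : L) s : c ^+ (q ^ s) = c ->
  exists h : {poly F}, map_poly phi h = \prod_(i < s) ('X - (c ^+ (q ^ i))%:P).
Proof.
case: s => [|s] cs; first by exists 1; rewrite rmorph1 big_ord0.
set P := \prod_(i < _) _.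
have XsubCq x : map_poly (powq qL) ('X - x%:P) = 'X - (x ^+ q)%:P.
  by rewrite rmorphB /= map_polyX map_polyC.
have Pq : map_poly (powq qL) P = P.
  rewrite rmorph_prod big_ord_recr [RHS]big_ord_recl mulrC; congr (_ * _); last first.
    by rewrite /= XsubCq -exprM -expnSr cs expr1.
  by apply: eq_bigr => i _; rewrite /= XsubCq -exprM -expnSr.
(* Each coefficient of [P] is Frobenius-fixed, so [pick] finds a preimage and the default 0 never
   arises. *)
exists (\poly_(i < size P) odflt 0 [pick a | phi a == P`_i]).
apply/polyP => i; rewrite coef_map coef_poly /=.
case: ltnP => [_|szP]; last by rewrite rmorph0 nth_default.
case: pickP => [a /eqP //|noa].
have [a /eqP] : exists a, phi a = P`_i; last by rewrite noa.
by apply: pow_card_fixed; rewrite -{2}Pq coef_map.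
Qed.

(** Otherwise [f] and [h] would be coprime over [F], hence over [L], where they share the root
    [b]. *)
Lemma irreducible_root_dvdp (f h : {poly F}) b : irreducible_poly f ->
  root (map_poly phi f) b -> root (map_poly phi h) b -> f %| h.
Proof.
move=> irr_f fb hb; apply: contraT => not_fh.
have : coprimep (map_poly phi f) (map_poly phi h).
  rewrite coprimep_map coprimep_def.
  apply: contraT => g1; case: irr_f => _ /(_ (gcdp f h) g1 (dvdp_gcdl _ _)) gf.
  by rewrite -(eqp_dvdl _ gf) dvdp_gcdr in not_fh.
by move/coprimep_root => /(_ b fb); rewrite -rootE hb.
Qed.

(** The orbit of [b] consists of roots of [f], so the period is at most [k]. Conversely the orbit
    polynomial descends to [F] and vanishes at [b], so [f] divides it. *)
Lemma pow_period_irreducible (f : {poly F}) b k : irreducible_poly f ->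
  size f = k.+1 -> root (map_poly phi f) b -> pow_period b k.
Proof.
move=> irr_f sz_f fb; have f0 := irredp_neq0 irr_f.
have [s per] := ex_pow_period f0 fb; have [s0 bs _] := per.
have le_sk : (s <= k)%N.
  rewrite -ltnS -sz_f -(size_map_poly phi f) -(size_mkseq (fun i => b ^+ (q ^ i)) s).
  apply: max_poly_roots (uniq_orbit per); first by rewrite map_poly_eq0.
  by apply/allP => _ /mapP[i _ ->]; apply: root_pow_card.
have [h h_eq] := orbit_poly_descent bs.
have hb : root (map_poly phi h) b.
  by rewrite h_eq -(prednK s0) big_ord_recl expr1 rootM root_XsubC eqxx.
suff -> : k = s by [].
have := dvdp_leq _ (irreducible_root_dvdp irr_f fb hb).
rewrite sz_f -(size_map_poly phi h) -(map_poly_eq0 phi) h_eq.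
rewrite size_prod_XsubC monic_neq0 ?monic_prod_XsubC // => /(_ isT) le_ks.
apply/eqP; rewrite eqn_leq le_sk andbT.
by move: le_ks; rewrite /index_enum -enumT size_enum_ord.
Qed.

Lemma irreducible_factor (f : {poly F}) b k : f \is monic -> irreducible_poly f ->
  size f = k.+1 -> root (map_poly phi f) b ->
  map_poly phi f = \prod_(i < k) ('X - (b ^+ (q ^ i))%:P).
Proof.
move=> mon_f irr_f sz_f fb.
have per := pow_period_irreducible irr_f sz_f fb.
rewrite [LHS](all_roots_prod_XsubC (rs := mkseq (fun i => b ^+ (q ^ i)) k)).
- rewrite lead_coef_map (monicP mon_f) rmorph1 scale1r big_map.
  by rewrite -[X in iota _ X]subn0 big_mkord.
- by rewrite size_map_poly size_mkseq.
- by apply/allP => _ /mapP[i _ ->]; apply: root_pow_card.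
by rewrite uniq_rootsE uniq_orbit.
Qed.

End Orbits.

(** A nonconstant factor of [T] has a root in [L], and the whole orbit of that root, of length at
    least [N], consists of roots of the factor. *)
Lemma irreducible_of_pow_period (F : finFieldType) (L : closedFieldType)
    (phi : {rmorphism F -> L}) (T : {poly F}) N :
    size T = N.+1 -> (0 < N)%N ->
    (forall b j, root (map_poly phi T) b -> (0 < j)%N -> b ^+ (#|F| ^ j) = b -> N <= j)%N ->
  irreducible_poly T.
Proof.
move=> sz_T N0 per_T; split=> [|p sz_p pT]; first by rewrite sz_T.
have T0 : T != 0 by rewrite -size_poly_eq0 sz_T.
have p0 : p != 0 by apply: contraNneq T0 => p0; rewrite p0 dvd0p in pT.
have [b pb] : exists b, root (map_poly phi p) b.
  by apply/closed_rootP; rewrite size_map_poly.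
have [s per] := ex_pow_period p0 pb; have [s0 bs _] := per.
have le_Ns : (N <= s)%N.
  apply: per_T s0 bs; rewrite !root_factor_theorem in pb *.
  by apply: dvdp_trans pb _; rewrite dvdp_map.
rewrite -dvdp_size_eqp // eqn_leq dvdp_leq //= sz_T.
apply: leq_ltn_trans le_Ns _.
rewrite -(size_map_poly phi p) -(size_mkseq (fun i => b ^+ (#|F| ^ i)) s).
apply: max_poly_roots (uniq_orbit phi per); first by rewrite map_poly_eq0.
by apply/allP => _ /mapP[i _ ->]; apply: root_pow_card.
Qed.

(** * Orders of the roots of X^t - theta^-u *)

(** If the order were a proper divisor of [t], then for some prime p dividing [t] the power
    zeta^(t/p) would be a d-th root of unity theta^j. Then [d] divides u + pj, and p, which divides
    [d], divides [u] as well as [t]. *)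
Lemma prim_root_exp_eq_pow (L : fieldType) (d : nat) (theta : L) (t u : nat) (zeta : L) :
    d.-primitive_root theta -> (0 < t)%N ->
    (forall p, prime p -> p %| t -> p %| d)%N -> coprime u t ->
  zeta ^+ t = theta ^- u -> t.-primitive_root (zeta ^+ d).
Proof.
move=> prim_th t0 td cop zt.
have yt : (zeta ^+ d) ^+ t = 1.
  by rewrite exprAC zt exprVn exprAC (prim_expr_order prim_th) expr1n invr1.
have [s prim_s /dvdnP[w t_eq]] := prim_order_exists t0 yt.
have [w1|w_neq1] := eqVneq w 1%N; first by rewrite t_eq w1 mul1n.
have w0 : (0 < w)%N by move: t0; rewrite t_eq muln_gt0 => /andP[].
set p := pdiv w; have pr_p : prime p by rewrite pdiv_prime // ltn_neqAle eq_sym w_neq1.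
have [v w_eq] := dvdnP (pdiv_dvd w); rewrite -/p in w_eq.
have p_t : (p %| t)%N by rewrite t_eq w_eq -mulnA mulnCA dvdn_mulr.
have : (zeta ^+ (v * s)) ^+ d = 1.
  by rewrite exprAC exprM exprAC (prim_expr_order prim_s) expr1n.
case/(prim_rootP prim_th) => j zj.
have : theta ^+ (u + p * j) = 1.
  have th0 : theta != 0 by rewrite (prim_root_eq0 prim_th) -lt0n (prim_order_gt0 prim_th).
  rewrite exprD mulnC exprM -zj -exprM.
  have -> : (v * s * p = t)%N by rewrite t_eq w_eq; ring.
  by rewrite zt mulfV // expf_neq0.
move/eqP; rewrite -(prim_order_dvd prim_th) => d_up.
have : (p %| gcdn u t)%N.
  rewrite dvdn_gcd p_t andbT -(dvdn_addl _ (dvdn_mulr j (dvdnn p))).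
  exact: dvdn_trans (td _ pr_p p_t) d_up.
by rewrite (eqP cop) dvdn1 => /eqP p1; rewrite p1 in pr_p.
Qed.

(** If a prime p divided both u and [t], then zeta^(t/p) theta^(u/p) would have p-th power 1.
    Raising it to the power [d], a multiple of p, would give zeta^d an order dividing t/p. *)
Lemma prim_root_pow_eq_exp (L : fieldType) (d : nat) (theta : L) (t : nat) (zeta : L) :
    d.-primitive_root theta -> (forall p, prime p -> p %| t -> p %| d)%N ->
    t.-primitive_root (zeta ^+ d) ->
  exists u, [/\ (1 <= u < d.+1)%N, coprime u t & zeta ^+ t = theta ^- u].
Proof.
move=> prim_th td prim_t.
have th0 : theta != 0 by rewrite (prim_root_eq0 prim_th) -lt0n (prim_order_gt0 prim_th).
have t0 := prim_order_gt0 prim_t.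
have : (zeta ^+ t) ^+ d = 1 by rewrite exprAC (prim_expr_order prim_t).
case/(prim_rootP prim_th) => j zj.
(* As [j < d], the exponent [d - j] lies in 1..d; the value 1 of [zeta ^+ t] corresponds to d, not
   0. *)
have zu : zeta ^+ t = theta ^- (d - j).
  apply: (mulIf (expf_neq0 (d - j) th0)).
  by rewrite mulVf ?expf_neq0 // zj -exprD subnKC ?(prim_expr_order prim_th) // ltnW.
exists (d - j)%N; split=> //; first by rewrite subn_gt0 ltn_ord ltnS leq_subr.
rewrite /coprime; apply: contraT => g1; set g := gcdn _ _ in g1.
have g0 : (0 < g)%N by rewrite gcdn_gt0 t0 orbT.
set p := pdiv g; have pr_p : prime p by rewrite pdiv_prime // ltn_neqAle eq_sym g1.
have pg : (p %| g)%N := pdiv_dvd g.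
have p_t : (p %| t)%N := dvdn_trans pg (dvdn_gcdr _ _).
have p_u : (p %| d - j)%N := dvdn_trans pg (dvdn_gcdl _ _).
have [v t_eq] := dvdnP p_t; have [w u_eq] := dvdnP p_u; have [c d_eq] := dvdnP (td _ pr_p p_t).
have : (zeta ^+ v * theta ^+ w) ^+ p = 1.
  by rewrite exprMn -!exprM -t_eq -u_eq zu mulVf // expf_neq0.
move/(congr1 (fun x => x ^+ c)); rewrite -exprM mulnC -d_eq expr1n exprMn.
rewrite [(theta ^+ w) ^+ d]exprAC (prim_expr_order prim_th) expr1n mulr1 exprAC => /eqP.
rewrite -(prim_order_dvd prim_t) => /dvdn_leq; rewrite t_eq.
have v0 : (0 < v)%N by move: t0; rewrite t_eq muln_gt0 => /andP[].
by move=> /(_ v0); rewrite leqNgt ltn_Pmulr // prime_gt1.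
Qed.

(** * Factorization of X^n - b^n over the closure, and periods of its roots *)

Lemma monic_dvd_prod_XsubC (L : fieldType) (rs : seq L) (P : {poly L}) :
    uniq rs -> P \is monic -> P %| \prod_(x <- rs) ('X - x%:P) ->
  P = \prod_(x <- rs | root P x) ('X - x%:P).
Proof.
move=> uniq_rs mon_P /dvdp_prod_XsubC[m]; rewrite eqp_monic ?monic_prod_XsubC //.
move=> /eqP P_eq; rewrite -big_filter {1}P_eq mask_filter //.
congr (bigop _ _ _); apply: eq_filter => x.
by rewrite P_eq root_prod_XsubC.
Qed.

(** The derivative n X^(n-1) vanishes at no root, so the roots are distinct. *)
Lemma XnsubC_roots (L : closedFieldType) n (c : L) : (0 < n)%N -> n%:R != 0 :> L ->
  c != 0 -> exists2 rs : seq L, uniq rs & 'X^n - c%:P = \prod_(x <- rs) ('X - x%:P).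
Proof.
move=> n0 nL c0; have [rs] := closed_field_poly_normal ('X^n - c%:P).
rewrite (monicP (monicXnsubC c n0)) scale1r => rs_eq; exists rs => //.
rewrite -separable_prod_XsubC -rs_eq separable_poly.unlock.
apply: Pdiv.ClosedField.root_coprimep => x.
rewrite rootE !hornerE subr_eq0 derivB derivC derivXn subr0 hornerMn hornerXn => /eqP xn.
rewrite -mulr_natr mulf_neq0 //; apply: expf_neq0; apply: contraNneq c0 => x0.
by rewrite -xn x0 expr0n gtn_eqF.
Qed.

(* A root x of X^n - b^n is a root of exactly one factor: t must be the order of (x / b)^d. *)
Lemma XnsubC_factorization (L : closedFieldType) (n d : nat) (theta b : L) :
    (0 < n)%N -> b != 0 -> d.-primitive_root theta -> (d %| n)%N ->
    (forall p, prime p -> p %| n -> p %| d)%N ->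
  'X^n - (b ^+ n)%:P = \prod_(t <- divisors (n %/ d))
     \prod_(1 <= u < d.+1 | coprime u t) ('X^t - (theta ^- u * b ^+ t)%:P).
Proof.
move=> n0 b0 prim_th dn nd; have d0 := prim_order_gt0 prim_th.
(* Every prime factor of [n] divides [d], and the existence of a primitive d-th root of unity keeps
   the characteristic from dividing [d]. *)
have nL : n%:R != 0 :> L.
  apply: (prim_root_pi_eq0 prim_th); apply/pnatP => // p pr_p pn.
  by rewrite mem_primes pr_p d0 nd.
have th0 : theta != 0 by rewrite (prim_root_eq0 prim_th) -lt0n.
set m := (n %/ d)%N; have m0 : (0 < m)%N by rewrite divn_gt0 // dvdn_leq.
have n_eq : (n = m * d)%N by rewrite divnK.
have bn0 : b ^+ n != 0 by rewrite expf_neq0.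
have [rs uniq_rs rs_eq] := XnsubC_roots n0 nL bn0.
have mem_rs x : (x \in rs) = (x ^+ n == b ^+ n).
  by rewrite -root_prod_XsubC -rs_eq rootE !hornerE subr_eq0.
have prim_div t x u : (t %| m)%N -> coprime u t -> x ^+ t = theta ^- u * b ^+ t ->
    t.-primitive_root ((x / b) ^+ d).
  move=> tm cop xt; apply: prim_root_exp_eq_pow prim_th (dvdn_gt0 m0 tm) _ cop _.
    by move=> p pr_p pt; apply: nd; rewrite ?n_eq // dvdn_mulr // (dvdn_trans pt).
  by rewrite expr_div_n xt mulfK ?expf_neq0.
(* Since [d] divides n/t, the constant theta^-u b^t has (n/t)-th power b^n, so the binomial divides
   X^n - b^n. *)
have factor t u : (t %| m)%N -> 'X^t - (theta ^- u * b ^+ t)%:P =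
    \prod_(x <- rs) if x ^+ t == theta ^- u * b ^+ t then 'X - x%:P else 1.
  move=> tm; have t0 := dvdn_gt0 m0 tm.
  rewrite -big_mkcond [LHS](monic_dvd_prod_XsubC uniq_rs) ?monicXnsubC //.
    by apply: eq_bigl => x; rewrite rootE !hornerE subr_eq0.
  rewrite -rs_eq; have [w m_eq] := dvdnP tm.
  have -> : 'X^n - (b ^+ n)%:P = ('X^t) ^+ (w * d) - ((theta ^- u * b ^+ t)%:P) ^+ (w * d).
    have n_eq' : n = (t * (w * d))%N by rewrite n_eq m_eq; ring.
    rewrite -exprM -n_eq' -rmorphXn /= exprMn -exprM -n_eq' mulnC exprM exprVn.
    by rewrite [(theta ^+ u) ^+ d]exprAC (prim_expr_order prim_th) expr1n invr1 expr1n mul1r.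
  by rewrite subrXX dvdp_mulr.
(* Both sides become products over the roots x; for each x, exactly one pair (t, u) must contribute
   X - x. *)
rewrite rs_eq; under [RHS]eq_big_seq => t.
  rewrite -dvdn_divisors // => tm.
  rewrite big_mkcond; under eq_bigr => u _ do rewrite factor //.
  under eq_bigr => u _.
    have -> : (if coprime u t then \prod_(x <- rs)
        (if x ^+ t == theta ^- u * b ^+ t then 'X - x%:P else 1) else 1) =
      \prod_(x <- rs) if coprime u t && (x ^+ t == theta ^- u * b ^+ t)
        then 'X - x%:P else 1.
      by case: ifP => //= _; rewrite big1.
  over.
  rewrite exchange_big.
over.
rewrite exchange_big; apply: eq_big_seq => x /=; rewrite mem_rs => /eqP xn.
have : ((x / b) ^+ d) ^+ m = 1 by rewrite -exprM mulnC -n_eq expr_div_n xn divff.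
case/(prim_order_exists m0) => t prim_t tm.
have td p : prime p -> (p %| t -> p %| d)%N.
  by move=> pr_p pt; apply: nd; rewrite ?n_eq // dvdn_mulr // (dvdn_trans pt).
have [u [u_range cop xt]] := prim_root_pow_eq_exp prim_th td prim_t.
have {}xt : x ^+ t = theta ^- u * b ^+ t by rewrite -xt expr_div_n divfK ?expf_neq0.
rewrite (bigD1_seq t) ?divisors_uniq -?dvdn_divisors //=.
rewrite (bigD1_seq u) ?iota_uniq ?mem_index_iota //= cop xt eqxx /=.
rewrite !big1_seq ?mulr1 //.
  move=> t' /andP[tt']; rewrite -dvdn_divisors // => t'm.
  rewrite big1 // => u' _; case: ifP => // /andP[cop' /eqP xt'].
  have prim_t' := prim_div _ _ _ t'm cop' xt'.
  case/eqP: tt'; apply/eqP; rewrite eqn_dvd (prim_order_dvd prim_t) (prim_order_dvd prim_t').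
  by rewrite (prim_expr_order prim_t) (prim_expr_order prim_t') eqxx.
move=> u' /andP[uu']; rewrite mem_index_iota => u'_range.
case: ifP => // /andP[_ /eqP] /(mulIf (expf_neq0 t b0))/invr_inj/eqP.
rewrite (eq_prim_root_expr prim_th) => eq_uu'.
(* The power of [theta] fixes the exponent modulo [d], and 1..d contains each residue once. *)
suff eqm v w : (1 <= v < d.+1)%N -> (1 <= w < d.+1)%N -> (v <= w)%N ->
    v == w %[mod d] -> v = w.
  by case/eqP: uu'; case/orP: (leq_total u u') => le_uu'; [symmetry|]; apply: eqm;
    rewrite // eq_sym.
move=> /andP[v0 _] /andP[_ wd] vw; rewrite eq_sym eqn_mod_dvd // => dwv.
apply/eqP; rewrite eqn_leq vw -subn_eq0 -leqn0 leqNgt; apply/negP => wv0.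
have := dvdn_leq wv0 dwv; rewrite leqNgt => /negP[]; rewrite ltnS in wd.
by apply: leq_trans wd; rewrite ltn_subrL v0 (leq_trans v0 vw).
Qed.

(* zeta^(1 + q + ... + q^(j-1)) is killed by both n and q - 1, hence by d, while
   zeta^d has order t. *)
Lemma dvdn_pow_period_root (L : fieldType) (q n d t u j : nat) (theta zeta : L) :
    (0 < q)%N -> (0 < n)%N -> (forall p, prime p -> p %| n -> p %| q - 1)%N ->
    ((8 %| n)%N -> q = 1 %[mod 4]) -> d = gcdn n (q - 1) ->
    d.-primitive_root theta -> (t %| n %/ d)%N -> coprime u t ->
    zeta != 0 -> zeta ^+ t = theta ^- u -> zeta ^+ (q ^ j) = zeta ->
  (t %| j)%N.
Proof.
move=> q0 n0 nq h8 d_eq prim_th tm cop z0 zt zj.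
have dn : (d %| n)%N by rewrite d_eq dvdn_gcdl.
have dq : (d %| q - 1)%N by rewrite d_eq dvdn_gcdr.
have d0 := prim_order_gt0 prim_th.
have n_eq : (n = n %/ d * d)%N by rewrite divnK.
have m0 : (0 < n %/ d)%N by rewrite divn_gt0 // dvdn_leq.
have tn : (t %| n)%N by rewrite n_eq dvdn_mulr.
have t0 := dvdn_gt0 n0 tn.
have tq p : prime p -> (p %| t -> p %| q - 1)%N.
  by move=> pr_p pt; apply: nq; rewrite ?(dvdn_trans pt).
have td p : prime p -> (p %| t -> p %| d)%N.
  by move=> pr_p pt; rewrite d_eq dvdn_gcd tq // (dvdn_trans pt).
have prim_z := prim_root_exp_eq_pow prim_th t0 td cop zt.
apply: (dvdn_geometric_sum t0 q0 tq) => [t4|].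
  (* If 4 divides [t], then 2 divides [d]; as [t] divides n/d, 8 divides [n]. *)
  rewrite -eqn_mod_dvd //; apply/eqP/h8.
  rewrite n_eq (_ : 8 = 4 * 2)%N // dvdn_mul ?(dvdn_trans t4) //.
  by apply: td => //; apply: dvdn_trans t4.
set S := (\sum_(i < j) q ^ i)%N.
have zq : zeta ^+ (S * (q - 1)) = 1.
  apply: (mulIf z0); rewrite mul1r -exprSr mulnC subn1 -predn_exp prednK //.
  by rewrite expn_gt0 q0.
have zn : zeta ^+ (S * n) = 1.
  have [w m_eq] := dvdnP tm.
  have -> : (S * n = t * (d * (w * S)))%N by rewrite n_eq m_eq; ring.
  rewrite exprM zt exprM exprVn [(theta ^+ u) ^+ d]exprAC (prim_expr_order prim_th).
  by rewrite expr1n invr1 expr1n.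
have [s prim_s s_n] : {s | s.-primitive_root (zeta ^+ S) & (s %| n)%N}.
  by apply: prim_order_exists; rewrite -?exprM.
rewrite (prim_order_dvd prim_z) exprAC -(prim_order_dvd prim_s) d_eq dvdn_gcd s_n.
by rewrite (prim_order_dvd prim_s) -exprM zq eqxx.
Qed.

(** * Twists over the closure, and assembly of the factorization *)

Lemma map_twist (F L : fieldType) (phi : {rmorphism F -> L}) theta k t u (g : {poly F}) :
  map_poly phi (twist theta k t u g) = twist (phi theta) k t u (map_poly phi g).
Proof.
by rewrite /twist map_polyZ map_comp_poly map_polyZ map_polyXn fmorphV !rmorphXn.
Qed.

(** The scalar theta^-(uk) supplies one theta^-u to each of the [k] factors, making it monic. *)
Lemma twist_prod_XsubC (L : fieldType) (theta : L) k t u (c : nat -> L) : theta != 0 ->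
  twist theta k t u (\prod_(i < k) ('X - (c i)%:P)) =
    \prod_(i < k) ('X^t - (theta ^- u * c i)%:P).
Proof.
move=> th0; rewrite /twist rmorph_prod.
have -> : theta ^- (u * k) = \prod_(i < k) theta ^- u.
  by rewrite prodr_const card_ord exprM exprVn.
rewrite -scaler_prod; apply: eq_bigr => i _.
rewrite /= comp_polyB comp_polyX comp_polyC scalerBr scalerA mulVf ?expf_neq0 //.
by rewrite scale1r -mul_polyC -polyCM.
Qed.

Lemma size_prod_XnsubC (R : idomainType) k t (c : nat -> R) : (0 < t)%N ->
  size (\prod_(i < k) ('X^t - (c i)%:P)) = (k * t).+1.
Proof.
move=> t0; rewrite size_prod => [|i _]; last by rewrite monic_neq0 ?monicXnsubC.
under eq_bigr => i _ do rewrite size_XnsubC //.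
by rewrite sum_nat_const card_ord mulnS subSn ?leq_addr // addKn.
Qed.

Theorem theorem2p3 (F : finFieldType) (q : nat) (hq : #|F| = q)
    (L : closedFieldType) (iota : {rmorphism F -> L})
    (hL : is_algebraic_closure iota)
    (n : nat) (hn : (0 < n)%N)
    (hnq : forall p : nat, prime p -> (p %| n)%N -> (p %| q - 1)%N)
    (h8 : (8 %| n)%N -> q = 1 %[mod 4])
    (f : {poly F}) (fmonic : f \is monic) (firr : irreducible_poly f)
    (f0 : f.[0] != 0)
    (k : nat) (hk : size f = k.+1)
    (e : nat) (he : is_poly_order f e)
    (hekn : coprime (e * k) n)
    (r : nat) (hr : (0 < r)%N) (hnr : (n * r)%N = 1 %[mod e])
    (alpha : L) (halpha : root (map_poly iota f) alpha)
    (d : nat) (hd : d = gcdn n (q - 1))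
    (theta : F) (htheta : d.-primitive_root theta)
    (m : nat) (hm : m = (n %/ d)%N) :
  exists g : nat -> {poly F},
    [/\ forall t : nat, (t %| m)%N ->
          map_poly iota (g t) = conj_poly q k r alpha t,
        forall t u : nat, (t %| m)%N -> (1 <= u <= d)%N -> coprime u t ->
          twist theta k t u (g t) \is monic /\
          irreducible_poly (twist theta k t u (g t))
      & f \Po 'X^n =
          \prod_(t <- divisors m) \prod_(1 <= u < d.+1 | coprime u t)
            twist theta k t u (g t)].
Proof.
have q1 : (1 < q)%N by rewrite -hq finNzRing_gt1.
have q0 := ltnW q1.
have d0 := prim_order_gt0 htheta.
have dn : (d %| n)%N by rewrite hd dvdn_gcdl.
have n_eq : (n = m * d)%N by rewrite hm divnK.
have m0 : (0 < m)%N by rewrite hm divn_gt0 // dvdn_leq.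
have k0 : (0 < k)%N by case: firr; rewrite hk.
pose th := iota theta.
have prim_th : d.-primitive_root th by rewrite fmorph_primitive_root.
have th0 : th != 0 by rewrite (prim_root_eq0 prim_th) -lt0n.
have a0 : alpha != 0.
  apply: contraNneq f0 => alpha0; move: halpha; rewrite alpha0 rootE.
  by rewrite -[X in _.[X]](rmorph0 iota) horner_map fmorph_eq0.
have per_a : pow_period F alpha k := pow_period_irreducible firr hk halpha.
have [_ ak _] := per_a; rewrite hq in ak.
have ae : alpha ^+ e = 1.
  case: he => _ f_dvd _; apply/eqP; rewrite -subr_eq0.
  have : root (map_poly iota ('X^e - 1)) alpha.
    rewrite !root_factor_theorem in halpha *.
    by apply: dvdp_trans halpha _; rewrite dvdp_map.
  by rewrite rmorphB /= map_polyXn rmorph1 rootE !hornerE.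
(* These are the conjugates of alpha^r; as nr is 1 modulo [e], they are n-th roots of the conjugates
   of [alpha]. *)
pose b i := alpha ^+ (r * q ^ i).
have b0 i : b i != 0 by rewrite expf_neq0.
have bn i : b i ^+ n = alpha ^+ (q ^ i).
  rewrite -exprM (_ : r * q ^ i * n = n * r * q ^ i)%N; last by ring.
  by rewrite exprM -(expr_mod _ ae) hnr (expr_mod _ ae) expr1.
(* The boolean equality lets [xchoose] turn existence into a function of [t]. *)
have g_ex t : exists h : {poly F}, map_poly iota h == conj_poly q k r alpha t.
  have ck : (alpha ^+ (t * r)) ^+ (#|F| ^ k) = alpha ^+ (t * r) by rewrite exprAC hq ak.
  have [h h_eq] := orbit_poly_descent iota ck; exists h; apply/eqP; rewrite h_eq.
  by apply: eq_bigr => i _; rewrite -exprM hq.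
pose g t := xchoose (g_ex t).
have gE t : map_poly iota (g t) = conj_poly q k r alpha t := eqP (xchooseP (g_ex t)).
have twistE t u : map_poly iota (twist theta k t u (g t)) =
    \prod_(i < k) ('X^t - (th ^- u * b i ^+ t)%:P).
  rewrite map_twist gE.
  rewrite [LHS](twist_prod_XsubC _ _ _ (fun i => alpha ^+ (t * r * q ^ i)) th0).
  apply: eq_bigr => i _.
  by rewrite -exprM (_ : r * q ^ i * t = t * r * q ^ i)%N //; ring.
exists g; split=> // [t u tm u_range cop|].
  have tn : (t %| n)%N by rewrite n_eq dvdn_mulr.
  have t0 := dvdn_gt0 m0 tm.
  set T := twist _ _ _ _ _.
  have sz_T : size T = (k * t).+1.
    rewrite -(size_map_poly iota) twistE.
    exact: (size_prod_XnsubC k (fun i => th ^- u * b i ^+ t) t0).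
  split.
    rewrite -(map_monic iota) twistE; apply: monic_prod => i _.
    exact: monicXnsubC.
  apply: (irreducible_of_pow_period (phi := iota) sz_T); first by rewrite muln_gt0 k0.
  move=> x j; rewrite twistE hq => Tx j0 xj; apply: dvdn_leq => //.
  have [i _ xt] : exists2 i : 'I_k, true & x ^+ t = th ^- u * b i ^+ t.
    move: Tx; rewrite rootE horner_prod => /prodf_eq0[i _].
    by rewrite !hornerE subr_eq0 => /eqP; exists i.
  have x0 : x != 0.
    apply: contraTneq (mulf_neq0 (invr_neq0 (expf_neq0 u th0)) (expf_neq0 t (b0 i))) => x0.
    by rewrite -xt x0 expr0n gtn_eqF // eqxx.
  have xn : x ^+ n = alpha ^+ (q ^ i).
    have [w m_eq] := dvdnP tm; rewrite -bn.
    have n_eq' : n = (t * (d * w))%N by rewrite n_eq m_eq; ring.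
    rewrite n_eq' exprM xt exprMn -[X in _ * X]exprM exprM exprVn.
    by rewrite [(th ^+ u) ^+ d]exprAC (prim_expr_order prim_th) expr1n invr1 expr1n mul1r.
  (* The conjugate [x ^+ n] of [alpha] has period [j]; cancelling the i-th Frobenius iterate gives
     the same for [alpha]. *)
  have aj : alpha ^+ (q ^ j) = alpha.
    rewrite -hq; apply: (pow_pchar_inj (pchar_nat_card iota) (i := i)).
    by rewrite /= hq exprAC -xn exprAC xj.
  rewrite Gauss_dvd; last first.
    apply: coprime_dvdr tn _; move: hekn; rewrite coprimeMl => /andP[_ //].
  apply/andP; split; first by apply: (pow_period_dvd per_a); rewrite hq.
  (* The quotient by [b i] has t-th power theta^-u, and it keeps the period [j] because [b i] is a
     power of [alpha]. *)
  apply: (dvdn_pow_period_root q0 hn hnq h8 hd prim_th (zeta := x / b i)) cop _ _ _.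
  - by rewrite -hm.
  - by rewrite mulf_neq0 ?invr_neq0.
  - by rewrite expr_div_n xt mulfK ?expf_neq0.
  - by rewrite expr_div_n xj exprAC aj.
(* The identity is checked over [L]: each conjugate of [alpha] contributes a binomial X^n - b_i^n,
   and exchanging the products collects the factors with equal (t, u). *)
apply: (map_poly_inj iota); rewrite map_comp_poly map_polyXn.
rewrite (irreducible_factor fmonic firr hk halpha) hq rmorph_prod /=.
have nd p : prime p -> (p %| n -> p %| d)%N.
  by move=> pr_p pn; rewrite hd dvdn_gcd pn hnq.
under eq_bigr => i _.
  rewrite comp_polyB comp_polyX comp_polyC -bn.
  rewrite (XnsubC_factorization hn (b0 i) prim_th dn nd) -hm.
  over.
rewrite exchange_big rmorph_prod; apply: eq_bigr => t _ /=.
rewrite exchange_big rmorph_prod; apply: eq_bigr => u _ /=.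
by rewrite twistE.
Qed.
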